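(* Let $m$ be an even positive integer, let $\tilde H\in\Omega_{4n}$ be invertible and Hermitian, and let $\tilde B\in\Omega_{4n}$ be $\tilde H$-selfadjoint with $\sigma(\tilde B)\subset(-\infty,0)$. Then there exists an $\tilde H$-selfadjoint $\tilde A\in\Omega_{4n}$ with $\tilde A^m=\tilde B$ if and only if there exist an invertible $S\in\Omega_{4n}$, an integer $t$, integers $k_j\ge1$ and numbers $\lambda_j<0$ ($j=1,\dots,t$) such that $$S^{-1}\tilde BS=\bigoplus_{j=1}^t\big(J_{k_j}(\lambda_j)\oplus J_{k_j}(\lambda_j)\big)\oplus\bigoplus_{j=1}^t\big(J_{k_j}(\lambda_j)\oplus J_{k_j}(\lambda_j)\big),$$ $$S^*\tilde HS=\bigoplus_{j=1}^t\big(Q_{k_j}\oplus -Q_{k_j}\big)\oplus\bigoplus_{j=1}^t\big(Q_{k_j}\oplus -Q_{k_j}\big).$$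
   Context: $\Omega_{2k}=\{\begin{bmatrix}A_1&\bar A_2\\-A_2&\bar A_1\end{bmatrix}: A_1,A_2\in\mathbb{C}^{k\times k}\}\subset\mathbb{C}^{2k\times 2k}$. $J_k(\lambda)$: $k\times k$ upper triangular Jordan block with eigenvalue $\lambda$; $Q_k$: $k\times k$ matrix with ones on the main anti-diagonal and zeros elsewhere; $\oplus$: block diagonal sum. For invertible Hermitian $H$, $A$ is $H$-selfadjoint if $HA=A^*H$. *)

(* Defs.v *)
From HB Require Import structures.
From mathcomp Require Import all_boot all_order all_algebra.
Set Implicit Arguments. Unset Strict Implicit. Unset Printing Implicit Defensive.
Import Order.TTheory GRing.Theory Num.Theory.
Local Open Scope ring_scope.

Section Defs.
Variable C : numClosedFieldType.

Definition conjmx {m n} (A : 'M[C]_(m, n)) : 'M[C]_(m, n) := map_mx Num.conj A.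
Definition adjmx {m n} (A : 'M[C]_(m, n)) : 'M[C]_(n, m) := (conjmx A)^T.

Definition Omega (k : nat) (M : 'M[C]_(k + k)) : Prop :=
  exists A1 A2 : 'M[C]_k, M = block_mx A1 (conjmx A2) (- A2) (conjmx A1).

Definition herm_mx {n} (H : 'M[C]_n) : Prop := adjmx H = H.

Definition H_selfadjoint {n} (H A : 'M[C]_n) : Prop := H *m A = adjmx A *m H.

Definition jordan (k : nat) (lam : C) : 'M[C]_k :=
  \matrix_(i < k, j < k)
    (if i == j :> nat then lam else if j == i.+1 :> nat then 1 else 0).

Definition Qmx (k : nat) : 'M[C]_k := \matrix_(i < k, j < k) ((i + j)%N == k.-1)%:R.

Fixpoint bdiag (s : seq {k : nat & 'M[C]_k}) :
    'M[C]_(sumn [seq projT1 x | x <- s]) :=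
  match s return 'M[C]_(sumn [seq projT1 x | x <- s]) with
  | [::] => 0
  | x :: s' => block_mx (projT2 x) 0 0 (bdiag s')
  end.

Definition jordan_blocks (s : seq (nat * C)) : seq {k : nat & 'M[C]_k} :=
  flatten [seq [:: existT _ p.1 (jordan p.1 p.2); existT _ p.1 (jordan p.1 p.2)] | p <- s].

Definition Q_blocks (s : seq (nat * C)) : seq {k : nat & 'M[C]_k} :=
  flatten [seq [:: existT _ p.1 (Qmx p.1); existT _ p.1 (- Qmx p.1)] | p <- s].

End Defs.

(* Main.v *)
Require Import Defs.
From mathcomp Require Import all_boot all_order all_algebra.
From mathcomp Require Import zify ring.
Set Implicit Arguments. Unset Strict Implicit. Unset Printing Implicit Defensive.
Import Order.TTheory GRing.Theory Num.Theory.
Local Open Scope ring_scope.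

(** Let J be the antilinear map v |-> K conj(v) with K = [[0, -1], [1, 0]]: Omega
    is the set of matrices commuting with J, and J^2 = -1.

    If A is an H-selfadjoint m-th root of B in Omega, then A has no real
    eigenvalue since m is even, so some real polynomial Phi in A satisfies
    Phi^2 = -1.  The eigenspace V of Phi for i is H-neutral, and its complement
    JV is the eigenspace for -i.  Hence g(x, y) = [J x, y]_H is a nondegenerate
    bilinear form on V; it is alternating, and B is g-selfadjoint.  Operators that
    are selfadjoint for a symplectic form have paired Jordan chains e, f with
    g(e, f) = Q, and e - J f, e + J f, divided by sqrt 2, are chains of B of signs
    +1 and -1.

    Conversely, let R be a polynomial in J_k(lam) with R^m = J_k(lam).  In the
    basis diagonalising the swap of the two copies of J_k(lam), the block
    diagonal matrix diag(R, conj(R)) is an m-th root of J_k(lam) (+) J_k(lam), and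
    it is selfadjoint for Q (+) -Q although R is not real. *)

(* After the imports, [conjmx] means conjugation by a similarity. *)
Local Notation cmx := (@Defs.conjmx _ _ _).

(** * Factorisation of idempotents, and intertwining relations for polynomials and powers of
    matrices *)

Lemma idempotent_mx_factor (F : fieldType) N (P : 'M[F]_N) : P *m P = P ->
  exists r (X : 'M[F]_(N, r)) (Z : 'M[F]_(r, N)), X *m Z = P /\ Z *m X = 1%:M.
Proof.
move=> PP; exists (\rank P), (col_base P), (row_base P).
have H := mulmx_base P; split=> //.
have := col_base_full P; have := row_base_free P.
move: (\rank P) (col_base P) (row_base P) H => r X Z defP.
(* Cancelling the full-rank factors of P = X Z on both sides of P P = P leaves Z X = 1. The columns
   of X are a basis of the image of P, and Z gives coordinates in it. *)
case/row_freeP=> Z' ZZ' /row_fullP[X' X'X].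
have: X' *m (P *m P) *m Z' = X' *m P *m Z' by rewrite PP.
by rewrite -defP !mulmxA X'X !mul1mx -!mulmxA ZZ' !mulmx1.
Qed.

Lemma horner_mx_intertwine (F : comNzRingType) m n (A : 'M[F]_m.+1)
    (A' : 'M[F]_n.+1) (L : 'M[F]_(n.+1, m.+1)) (p : {poly F}) :
  L *m A = A' *m L -> L *m horner_mx A p = horner_mx A' p *m L.
Proof.
move=> LA; elim/poly_ind: p => [|p c IH]; first by rewrite !rmorph0 mulmx0 mul0mx.
rewrite !rmorphD !rmorphM /= !horner_mx_X !horner_mx_C mulmxDr mulmxDl.
by rewrite -!mulmxE mulmxA IH -!mulmxA LA mul_mx_scalar mul_scalar_mx.
Qed.

Lemma tr_horner_mx (F : comNzRingType) n (A : 'M[F]_n.+1) (p : {poly F}) :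
  (horner_mx A p)^T = horner_mx A^T p.
Proof.
elim/poly_ind: p => [|p c IH]; first by rewrite !rmorph0 trmx0.
rewrite !rmorphD !rmorphM /= !horner_mx_X !horner_mx_C -!mulmxE linearD /= trmx_mul IH.
by rewrite tr_scalar_mx (@horner_mx_intertwine _ _ _ A^T A^T A^T).
Qed.

Lemma mulmx_expr_intertwine (F : pzRingType) n (L A A' : 'M[F]_n) a :
  L *m A = A' *m L -> L *m (A ^+ a) = (A' ^+ a) *m L.
Proof.
move=> LA; elim: a => [|a IH]; first by rewrite !expr0 mulmx1 mul1mx.
by rewrite !exprS -!mulmxE mulmxA LA -!mulmxA IH.
Qed.

Lemma trmx_expr (F : comPzRingType) n (A : 'M[F]_n) a : (A ^+ a)^T = A^T ^+ a.
Proof.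
by elim: a => [|a IH]; rewrite ?expr0 ?trmx1 // exprS exprSr -!mulmxE trmx_mul IH.
Qed.

(** * Jordan chains and orthogonal splitting for operators selfadjoint for a skew form *)

Section Symplectic.
Variable C : numClosedFieldType.

(* Write the minimal polynomial as q (X - lam)^(k+1) with q(lam) <> 0: then
   q(B) (B - lam)^k is nonzero with columns in the lam-primary component, and
   a Bezout idempotent moves the other argument of the form there as well. *)
Lemma primary_pair n (G B : 'M[C]_n.+1) :
    G \in unitmx -> G *m B = B^T *m G ->
  exists lam k (x y : 'cV[C]_n.+1), let M := B - lam%:M in
  [/\ eigenvalue B lam, M ^+ k.+1 *m x = 0, M ^+ k.+1 *m y = 0
    & x^T *m G *m M ^+ k *m y != 0].
Proof.
move=> uG GB.
have [lam rlam] : exists lam, root (mxminpoly B) lam.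
  by apply/closed_rootP; rewrite size_mxminpoly eqSS -lt0n mxminpoly_nonconstant.
have nz : mxminpoly B != 0 by rewrite monic_neq0 ?mxminpoly_monic.
have [k [q /implyP/(_ nz) rq defp]] := multiplicity_XsubC (mxminpoly B) lam.
case: k defp => [|k] defp; first by rewrite defp mulr1 (negPf rq) in rlam.
exists lam, k; set M := B - lam%:M; pose l := 'X - lam%:P.
have HM a : horner_mx B (l ^+ a) = M ^+ a.
  by rewrite rmorphXn rmorphB /= horner_mx_X horner_mx_C.
have kill : horner_mx B q *m M ^+ k.+1 = 0.
  by rewrite -HM mulmxE -rmorphM /= -defp mx_root_minpoly.
have [[u v] /= Buv] : exists u, u.1 * q + u.2 * l ^+ k.+1 = 1.
  by apply/Bezout_eq1_coprimepP; rewrite coprimep_expr // coprimep_XsubC.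
pose W := horner_mx B q *m M ^+ k.
have nzW : W != 0.
  rewrite /W -HM mulmxE -rmorphM; apply/eqP=> /mxminpoly_min /dvdp_leq.
  have qn0 : q != 0 by apply: contraNneq rq => ->; rewrite root0.
  rewrite mulf_neq0 ?expf_neq0 ?polyXsubC_eq0 // => /(_ isT).
  rewrite defp !size_Mmonic ?monic_exp ?monicXsubC // !size_exp_XsubC.
  by rewrite !addnS /= ltnn.
have comm p p' : horner_mx B p *m horner_mx B p' = horner_mx B p' *m horner_mx B p.
  by rewrite mulmxE -!rmorphM mulrC.
have defW : G *m W = (horner_mx B (u * q))^T *m G *m M ^+ k *m horner_mx B q.
  rewrite tr_horner_mx -(horner_mx_intertwine _ GB) -!mulmxA; congr (_ *m _).
  rewrite /W -HM !mulmxE -!rmorphM; apply/eqP; rewrite -subr_eq0 -rmorphB -dvd_mxminpoly.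
  have -> : q * l ^+ k - u * q * (l ^+ k * q) = v * l ^+ k * mxminpoly B.
    rewrite defp -/l -[X in X - _]mul1r -Buv exprS; ring.
  exact: dvdp_mull.
have nzGW : G *m W != 0.
  by apply: contraNneq nzW => GW0; rewrite -[W](mulKmx uG) GW0 mulmx0.
have /matrix0Pn[i [j nzij]] := nzGW.
exists (horner_mx B (u * q) *m delta_mx i 0), (horner_mx B q *m delta_mx j 0).
split; first by rewrite eigenvalue_root_min.
- rewrite mulmxA -HM comm HM rmorphM /= -mulmxE.
  by rewrite -(mulmxA _ (horner_mx B q)) kill mulmx0 mul0mx.
- by rewrite mulmxA -HM comm HM kill mul0mx.
have pull (X1 X2 M' : 'M[C]_n.+1) : (X1 *m delta_mx i (0 : 'I_1))^T *m G *m M'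
    *m (X2 *m delta_mx j (0 : 'I_1))
    = delta_mx 0 i *m (X1^T *m G *m M' *m X2) *m delta_mx j 0.
  by rewrite trmx_mul trmx_delta !mulmxA.
apply: contraNneq nzij => /(congr1 (fun w : 'M_1 => w 0 0)).
by rewrite (pull (horner_mx B (u * q)) (horner_mx B q)) -defW -rowE -colE mxE mxE [RHS]mxE => ->.
Qed.
(** Since M is selfadjoint for G, the matrix G M^a is again skew. The 1 x 1 matrix in question
    therefore equals its own negative. *)
Lemma skew_form_alternating N (G M : 'M[C]_N) (x : 'cV[C]_N) a :
  G^T = - G -> G *m M = M^T *m G -> x^T *m G *m M ^+ a *m x = 0.
Proof.
move=> skG GM; set w := _ *m x.
have wT : w^T = - w.
  rewrite /w !trmx_mul trmxK skG trmx_expr mulNmx !mulmxN (mulmxA _ G).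
  by rewrite -(mulmx_expr_intertwine _ GM) !mulmxA.
have wTw : w^T = w by rewrite [w]mx11_scalar tr_scalar_mx.
apply/eqP; move/eqP: wT; rewrite wTw -addr_eq0 -mulr2n -scaler_nat scaler_eq0.
by rewrite pnatr_eq0.
Qed.

(** After scaling y so that the value at a = k is 1, the lower values are cleared downwards.
    Subtracting c M^(t+1) y removes the value c at a = k - t - 1, and it leaves every larger a alone
    because M^(k+1) y = 0. *)
Lemma chain_normalize N (L : 'rV[C]_N) (M : 'M[C]_N) k (y : 'cV[C]_N) :
    M ^+ k.+1 *m y = 0 -> L *m M ^+ k *m y != 0 ->
  exists2 y' : 'cV[C]_N, M ^+ k.+1 *m y' = 0
    & forall a, L *m M ^+ a *m y' = (a == k)%:R%:M.
Proof.
move=> My nz.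
have high (y' : 'cV_N) a : M ^+ k.+1 *m y' = 0 -> (k < a)%N -> M ^+ a *m y' = 0.
  by move=> My' lt; rewrite -(subnK lt) exprD -mulmxE -mulmxA My' mulmx0.
suff H t : (t <= k)%N -> exists2 y' : 'cV[C]_N, M ^+ k.+1 *m y' = 0
    & forall a, (k - t <= a)%N -> L *m M ^+ a *m y' = (a == k)%:R%:M.
  have [y' My' Hy'] := H k (leqnn k); exists y' => // a.
  by rewrite Hy' // subnn.
elim: t => [_|t IH ltk].
  pose c := (L *m M ^+ k *m y) 0 0.
  have cE : L *m M ^+ k *m y = c%:M by rewrite -mx11_scalar.
  have nzc : c != 0 by apply: contraNneq nz => c0; rewrite cE c0 raddf0.
  exists (c^-1 *: y) => [|a]; first by rewrite -scalemxAr My scaler0.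
  rewrite subn0 -scalemxAr leq_eqVlt => /predU1P[<-|lt].
    by rewrite cE eqxx scale_scalar_mx mulVf.
  by rewrite -mulmxA high // gtn_eqF // mulmx0 scaler0 raddf0.
have [y' My' H] := IH (ltnW ltk).
pose c := (L *m M ^+ (k - t.+1) *m y') 0 0.
have cE : L *m M ^+ (k - t.+1) *m y' = c%:M by rewrite -mx11_scalar.
exists (y' - c *: (M ^+ t.+1 *m y')) => [|a].
  rewrite mulmxBr My' -scalemxAr mulmxA mulmxE -exprD high //.
    by rewrite scaler0 subr0.
  by rewrite leq_addr.
rewrite mulmxBr -scalemxAr leq_eqVlt => /predU1P[<-|lt].
  rewrite cE -mulmxA (mulmxA (M ^+ _)) mulmxE -exprD mulmxA.
  rewrite subnK // H ?leq_subr // eqxx scale_scalar_mx mulr1 subrr ltn_eqF ?raddf0 //.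
  by lia.
rewrite H; last by lia.
rewrite -mulmxA (mulmxA (M ^+ a)) mulmxE -exprD high //; last by lia.
by rewrite mulmx0 scaler0 subr0.
Qed.

(** The powers descend, so the eigenvector end of the chain is column 0 and x is the last column.
    This order gives an upper triangular Jordan block. *)
Definition chain_mx N (M : 'M[C]_N) k (x : 'cV[C]_N) : 'M[C]_(N, k.+1) :=
  \matrix_(i, j) (M ^+ (k - j) *m x) i 0.

Lemma col_chain_mx N (M : 'M[C]_N) k (x : 'cV[C]_N) j :
  col j (chain_mx M k x) = M ^+ (k - j) *m x.
Proof. by apply/colP=> i; rewrite mxE mxE. Qed.

Lemma chain_mx_jordan N (B : 'M[C]_N) lam k (x : 'cV[C]_N) :
    let M := B - lam%:M in M ^+ k.+1 *m x = 0 ->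
  B *m chain_mx M k x = chain_mx M k x *m jordan k.+1 lam.
Proof.
move=> M Mx.
pose Nil : 'M[C]_k.+1 := \matrix_(i, j) (j == i.+1 :> nat)%:R.
have -> : jordan k.+1 lam = Nil + lam%:M.
  apply/matrixP=> i j; rewrite !mxE -val_eqE /=.
  have [->|_] := eqVneq (i : nat) j; first by rewrite ltn_eqF // add0r.
  by rewrite addr0; case: (_ == _).
have -> : B = M + lam%:M by rewrite subrK.
rewrite mulmxDl mulmxDr mul_scalar_mx mul_mx_scalar; congr (_ + _).
apply: (can_inj trmxK); apply/row_matrixP=> j; rewrite -!tr_col; congr (_^T).
rewrite !colE -!mulmxA -!colE col_chain_mx mulmxA mulmxE -exprS.
apply/colP=> i; rewrite [RHS]mxE.
(* M sends each column to its left neighbour, and it sends column 0 to M^(k+1) x = 0. *)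
case: (unliftP ord0 j) => [j'|] -> /=.
  rewrite (bigD1 (widen_ord (leqnSn k) j')) //= big1 => [|l neq].
    rewrite !mxE eqxx mulr1 addr0 subnSK //.
  rewrite !mxE lift0 eqSS.
  suff -> : (j' == l :> nat) = false by rewrite mulr0.
  by apply: contraNF neq => /eqP E; rewrite -val_eqE /= E.
by rewrite subn0 Mx mxE big1 // => l _; rewrite !mxE mulr0.
Qed.

Lemma gram_entry m n N (E : 'M[C]_(N, m)) (G : 'M[C]_N) (F : 'M[C]_(N, n)) i j :
  (E^T *m G *m F) i j = ((col i E)^T *m G *m col j F) 0 0.
Proof.
by rewrite tr_col rowE colE -!mulmxA (mulmxA _ F) (mulmxA _ (G *m F)) -rowE -colE !mxE.
Qed.

(** All powers of M can be moved to one side of the form, so an entry depends only on i + j. *)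
Lemma gram_chain_mx N (G M : 'M[C]_N) k (x y : 'cV[C]_N) i j :
    G *m M = M^T *m G ->
  ((chain_mx M k x)^T *m G *m chain_mx M k y) i j
  = (x^T *m G *m M ^+ (k - i + (k - j)) *m y) 0 0.
Proof.
move=> GM; rewrite gram_entry !col_chain_mx trmx_mul trmx_expr.
rewrite -[x^T *m _ *m G]mulmxA -(mulmx_expr_intertwine _ GM) exprD -mulmxE !mulmxA.
by [].
Qed.

(** As B Y = Y D and B is G-selfadjoint, the kernel of Y^T G is B-invariant. Invertibility of Y^T G
    Y makes this kernel a complement of the span of Y on which G stays nondegenerate. *)
Lemma orthocomplement_split N q (G B : 'M[C]_N) (Y : 'M[C]_(N, q)) (D : 'M[C]_q) :
    G \in unitmx -> G^T = - G -> G *m B = B^T *m G ->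
    Y^T *m G *m Y \in unitmx -> B *m Y = Y *m D ->
  exists r (X : 'M[C]_(N, r)) (B' : 'M[C]_r),
  [/\ (q + r = N)%N, Y^T *m G *m X = 0, B *m X = X *m B', X^T *m G *m X \in unitmx
    & forall a, eigenvalue B' a -> eigenvalue B a].
Proof.
move=> uG skG GB; set Th := _ *m Y => uTh BY.
(* [Y *m Y'] is the G-orthogonal projection onto the span of Y. *)
pose Y' := invmx Th *m Y^T *m G.
have Y'Y : Y' *m Y = 1%:M by rewrite /Y' -!mulmxA [Y^T *m _]mulmxA mulVmx.
have YGP : Y^T *m G *m (1%:M - Y *m Y') = 0.
  by rewrite mulmxBr mulmx1 /Y' !mulmxA mulmxV // mul1mx subrr.
have Y'P : Y' *m (1%:M - Y *m Y') = 0.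
  by rewrite mulmxBr mulmxA Y'Y mul1mx mulmx1 subrr.
have PY : (1%:M - Y *m Y') *m Y = 0.
  by rewrite mulmxBl -mulmxA Y'Y mul1mx mulmx1 subrr.
have [|r [X [Z [XZ ZX]]]] := @idempotent_mx_factor _ _ (1%:M - Y *m Y').
  by rewrite mulmxBl -mulmxA Y'P mulmx0 subr0 mul1mx.
have defX : X = (1%:M - Y *m Y') *m X by rewrite -XZ -mulmxA ZX mulmx1.
have defZ : Z = Z *m (1%:M - Y *m Y') by rewrite -XZ mulmxA ZX mul1mx.
have YGX : Y^T *m G *m X = 0 by rewrite defX mulmxA YGP mul0mx.
have Y'X : Y' *m X = 0 by rewrite defX mulmxA Y'P mul0mx.
have ZY : Z *m Y = 0 by rewrite defZ -mulmxA PY mulmx0.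
have one : Y *m Y' + X *m Z = 1%:M by rewrite XZ addrC subrK.
have YGB : Y^T *m G *m B = D^T *m (Y^T *m G).
  by rewrite -mulmxA GB mulmxA -trmx_mul BY trmx_mul mulmxA.
have BX : B *m X = X *m (Z *m B *m X).
  rewrite -[LHS]mul1mx -one mulmxDl /Y' -!mulmxA [Y^T *m _]mulmxA.
  by rewrite [_ *m G *m _]mulmxA YGB -!mulmxA (mulmxA Y^T) YGX !mulmx0 add0r.
have ZB : Z *m B = (Z *m B *m X) *m Z.
  rewrite -[LHS]mulmx1 -one mulmxDr !mulmxA -(mulmxA Z B) BY mulmxA ZY !mul0mx.
  by rewrite add0r.
exists r, X, (Z *m B *m X); split=> //.
- apply/eqP; rewrite eqn_leq; apply/andP; split.
    apply: (@mulmx1_min C _ _ (col_mx Y' Z) (row_mx Y X)).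
    by rewrite mul_col_row Y'Y Y'X ZY ZX -scalar_mx_block.
  apply: (@mulmx1_min C _ _ (row_mx Y X) (col_mx Y' Z)).
  by rewrite mul_row_col.
- have XGY : X^T *m G *m Y = 0.
    apply: (can_inj trmxK).
    by rewrite trmx0 !trmx_mul trmxK skG mulNmx mulmxN mulmxA YGX oppr0.
  (* The inverse of the restricted form is G^-1 compressed by Z: X Z = 1 - Y Y', and the Y part is
     killed by X^T G Y = 0. *)
  suff: (X^T *m G *m X) *m (Z *m invmx G *m Z^T) = 1%:M by case/mulmx1_unit.
  rewrite -!mulmxA (mulmxA X Z) XZ.
  rewrite mulmxBl mul1mx !mulmxBr (mulmxA G) mulmxV // mul1mx.
  by rewrite -trmx_mul ZX trmx1 !mulmxA XGY !mul0mx subr0.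
(* Eigenvectors for [eigenvalue] are row vectors, so Z B = B' Z carries v to v Z. *)
- move=> a /eigenvalueP[v vB nzv]; apply/eigenvalueP; exists (v *m Z).
    by rewrite -mulmxA ZB mulmxA vB scalemxAl.
  by apply: contraNneq nzv => vZ; rewrite -[v]mulmx1 -ZX mulmxA vZ mul0mx.
Qed.

End Symplectic.

(** * Block calculus for pairs of equal-sized blocks, and the symplectic canonical form *)

Section PairBlocks.
Variable C : numClosedFieldType.
Implicit Types (s : seq (nat * C)) (a b c e : forall p : nat * C, 'M[C]_p.1).

Fixpoint pair_dim s : nat :=
  if s is p :: s' then (p.1 + (p.1 + pair_dim s'))%N else 0%N.

(** The blocks a, b, c, e act on two copies of a k-dimensional space and X on the rest. The nesting
    k + (k + r) is the one that [bdiag] produces when it meets two blocks of size k. *)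
Definition pair_block k r (a b c e : 'M[C]_k) (X : 'M[C]_r) : 'M[C]_(k + (k + r)) :=
  block_mx a (row_mx b 0) (col_mx c 0) (block_mx e 0 0 X).

Fixpoint pair_diag a b c e s : 'M[C]_(pair_dim s) :=
  if s is p :: s' return 'M[C]_(pair_dim s)
  then pair_block (a p) (b p) (c p) (e p) (pair_diag a b c e s') else 0.

Lemma pair_blockM k r (a b c e a' b' c' e' : 'M[C]_k) (X X' : 'M[C]_r) :
  pair_block a b c e X *m pair_block a' b' c' e' X'
  = pair_block (a *m a' + b *m c') (a *m b' + b *m e')
               (c *m a' + e *m c') (c *m b' + e *m e') (X *m X').
Proof.
rewrite /pair_block !mulmx_block mul_row_col mul_row_block mul_block_col mul_col_row.
rewrite mul_mx_row mul_col_mx add_block_mx add_row_mx add_col_mx.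
by rewrite !(mulmx0, mul0mx, addr0, add0r).
Qed.

Lemma pair_blockD k r (a b c e a' b' c' e' : 'M[C]_k) (X X' : 'M[C]_r) :
  pair_block a b c e X + pair_block a' b' c' e' X'
  = pair_block (a + a') (b + b') (c + c') (e + e') (X + X').
Proof. by rewrite /pair_block !add_block_mx add_row_mx add_col_mx !addr0. Qed.

Lemma pair_blockZ k r z (a b c e : 'M[C]_k) (X : 'M[C]_r) :
  z *: pair_block a b c e X
  = pair_block (z *: a) (z *: b) (z *: c) (z *: e) (z *: X).
Proof. by rewrite /pair_block !scale_block_mx scale_row_mx scale_col_mx !scaler0. Qed.

Lemma tr_pair_block k r (a b c e : 'M[C]_k) (X : 'M[C]_r) :
  (pair_block a b c e X)^T = pair_block a^T c^T b^T e^T X^T.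
Proof. by rewrite /pair_block !tr_block_mx tr_row_mx tr_col_mx !trmx0. Qed.

Lemma map_pair_block (f : {rmorphism C -> C}) k r (a b c e : 'M[C]_k) (X : 'M[C]_r) :
  map_mx f (pair_block a b c e X)
  = pair_block (map_mx f a) (map_mx f b) (map_mx f c) (map_mx f e) (map_mx f X).
Proof. by rewrite /pair_block !map_block_mx map_row_mx map_col_mx !map_mx0. Qed.

Lemma pair_block1 k r : pair_block (1%:M : 'M[C]_k) 0 0 1%:M (1%:M : 'M_r) = 1%:M.
Proof. by rewrite /pair_block row_mx0 col_mx0 -!scalar_mx_block. Qed.

Lemma pair_blockX k r (a b : 'M[C]_k) (X : 'M[C]_r) m :
  (pair_block a 0 0 b X) ^+ m = pair_block (a ^+ m) 0 0 (b ^+ m) (X ^+ m).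
Proof.
elim: m => [|m IH]; first by rewrite !expr0 pair_block1.
by rewrite !exprS IH -!mulmxE pair_blockM !(mulmx0, mul0mx, addr0, add0r).
Qed.

Lemma pair_diagM a b c e a' b' c' e' s :
  pair_diag a b c e s *m pair_diag a' b' c' e' s
  = pair_diag (fun p => a p *m a' p + b p *m c' p) (fun p => a p *m b' p + b p *m e' p)
      (fun p => c p *m a' p + e p *m c' p) (fun p => c p *m b' p + e p *m e' p) s.
Proof. by elim: s => [|p s IH] /=; rewrite ?mulmx0 // pair_blockM IH. Qed.

Lemma pair_diagD a b c e a' b' c' e' s :
  pair_diag a b c e s + pair_diag a' b' c' e' s
  = pair_diag (fun p => a p + a' p) (fun p => b p + b' p)
      (fun p => c p + c' p) (fun p => e p + e' p) s.
Proof. by elim: s => [|p s IH] /=; rewrite ?addr0 // pair_blockD IH. Qed.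

Lemma pair_diagZ z a b c e s :
  z *: pair_diag a b c e s
  = pair_diag (fun p => z *: a p) (fun p => z *: b p)
      (fun p => z *: c p) (fun p => z *: e p) s.
Proof. by elim: s => [|p s IH] /=; rewrite ?scaler0 // pair_blockZ IH. Qed.

Lemma tr_pair_diag a b c e s :
  (pair_diag a b c e s)^T
  = pair_diag (fun p => (a p)^T) (fun p => (c p)^T) (fun p => (b p)^T) (fun p => (e p)^T) s.
Proof. by elim: s => [|p s IH] /=; rewrite ?trmx0 // tr_pair_block IH. Qed.

Lemma map_pair_diag (f : {rmorphism C -> C}) a b c e s :
  map_mx f (pair_diag a b c e s)
  = pair_diag (fun p => map_mx f (a p)) (fun p => map_mx f (b p))
      (fun p => map_mx f (c p)) (fun p => map_mx f (e p)) s.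
Proof. by elim: s => [|p s IH] /=; rewrite ?map_mx0 // map_pair_block IH. Qed.

Lemma eq_in_pair_diag a b c e a' b' c' e' s :
    (forall p, p \in s -> [/\ a p = a' p, b p = b' p, c p = c' p & e p = e' p]) ->
  pair_diag a b c e s = pair_diag a' b' c' e' s.
Proof.
elim: s => //= p s IH H; have [|-> -> -> ->] := H p; first exact: mem_head.
by rewrite IH // => p' sp'; apply: H; rewrite inE sp' orbT.
Qed.

Lemma pair_diag1 s : pair_diag (fun=> 1%:M) (fun=> 0) (fun=> 0) (fun=> 1%:M) s = 1%:M.
Proof. by elim: s => [|p s /= ->]; rewrite ?pair_block1 // [RHS]flatmx0. Qed.

Definition jordan_diag s : 'M[C]_(pair_dim s) :=
  pair_diag (fun p => jordan p.1 p.2) (fun=> 0) (fun=> 0) (fun p => jordan p.1 p.2) s.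

Definition Qdiag s : 'M[C]_(pair_dim s) :=
  pair_diag (fun p => Qmx C p.1) (fun=> 0) (fun=> 0) (fun p => - Qmx C p.1) s.

(** Gram matrix of paired chains e, f: each pair contributes the skew block [[0, Q], [-Q, 0]]. *)
Definition Qskew s : 'M[C]_(pair_dim s) :=
  pair_diag (fun=> 0) (fun p => Qmx C p.1) (fun p => - Qmx C p.1) (fun=> 0) s.

Lemma mul_Qmx k n (A : 'M[C]_(k, n)) i j : (Qmx C k *m A) i j = A (rev_ord i) j.
Proof.
rewrite mxE (bigD1 (rev_ord i)) //= big1 => [|l neq].
  rewrite !mxE /= (_ : _ == _) ?mul1r ?addr0 //.
  by apply/eqP; have := ltn_ord i; lia.
rewrite mxE (_ : _ == _ = false) ?mul0r //; apply: contraNF neq => /eqP E.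
by rewrite -val_eqE /=; apply/eqP; have := ltn_ord l; have := ltn_ord i; lia.
Qed.

Lemma tr_Qmx k : (Qmx C k)^T = Qmx C k.
Proof. by apply/matrixP=> i j; rewrite !mxE addnC. Qed.

Lemma Qmx_sqr k : Qmx C k *m Qmx C k = 1%:M.
Proof.
apply/matrixP=> i j; rewrite mul_Qmx !mxE -val_eqE /=; congr (_%:R).
by have := ltn_ord i; have := ltn_ord j; lia.
Qed.

Lemma map_Qmx (f : {rmorphism C -> C}) k : map_mx f (Qmx C k) = Qmx C k.
Proof. by apply/matrixP=> i j; rewrite !mxE rmorph_nat. Qed.

Lemma Qmx_jordan k lam : Qmx C k *m jordan k lam = (jordan k lam)^T *m Qmx C k.
Proof.
apply: (can_inj trmxK); rewrite [RHS]trmx_mul trmxK tr_Qmx.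
apply/matrixP=> i j; rewrite mul_Qmx mxE mul_Qmx !mxE /=.
have := ltn_ord i; have := ltn_ord j => ltj lti.
rewrite (_ : (k - j.+1 == i :> nat)%N = (k - i.+1 == j :> nat)%N); last by lia.
by rewrite (_ : (i == (k - j.+1).+1 :> nat)%N = (j == (k - i.+1).+1 :> nat)%N); last by lia.
Qed.

Lemma skew_Qblock_unit k : block_mx 0 (Qmx C k) (- Qmx C k) 0 \in unitmx.
Proof.
suff: block_mx 0 (Qmx C k) (- Qmx C k) 0 *m block_mx 0 (- Qmx C k) (Qmx C k) 0 = 1%:M.
  by case/mulmx1_unit.
rewrite mulmx_block !(mulmx0, mul0mx, addr0, add0r) mulNmx mulmxN opprK Qmx_sqr.
by rewrite -scalar_mx_block.
Qed.

(** Induction on the size. Vectors x, y from [primary_pair], with y normalised, generate two chains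
    that span a nondegenerate B-invariant subspace. The induction hypothesis applies to its
    orthogonal complement. *)
Theorem symplectic_selfadjoint_canonical N (G B : 'M[C]_N) :
    G \in unitmx -> G^T = - G -> G *m B = B^T *m G ->
  exists s (T : 'M[C]_(N, pair_dim s)),
  [/\ pair_dim s = N, {in s, forall p, (0 < p.1)%N /\ eigenvalue B p.2},
      B *m T = T *m jordan_diag s & T^T *m G *m T = Qskew s].
Proof.
have [n leNn] := ubnP N; elim: n N leNn G B => // n IH [|N] leNn G B uG skG GB.
  by exists [::], 0; split=> //; [rewrite mulmx0 mul0mx | rewrite mulmx0].
have [lam [k [x [y0 [eigB Mx My0 nz]]]]] := primary_pair uG GB.
have [y My xy] := chain_normalize My0 nz.
set M := B - lam%:M in Mx My xy.
have GM : G *m M = M^T *m G.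
  have -> : M^T = B^T - lam%:M by rewrite /M linearB /= tr_scalar_mx.
  by rewrite /M mulmxBr mulmxBl GB mul_mx_scalar mul_scalar_mx.
pose E := chain_mx M k x; pose F := chain_mx M k y.
have BE : B *m E = E *m jordan k.+1 lam by apply: chain_mx_jordan.
have BF : B *m F = F *m jordan k.+1 lam by apply: chain_mx_jordan.
(* Each chain is isotropic, because the form is skew and M is selfadjoint for it. *)
have EGE : E^T *m G *m E = 0.
  by apply/matrixP=> i j; rewrite gram_chain_mx // skew_form_alternating // !mxE.
have FGF : F^T *m G *m F = 0.
  by apply/matrixP=> i j; rewrite gram_chain_mx // skew_form_alternating // !mxE.
(* Entry (i, j) is x^T G M^(2k-i-j) y, which by normalisation is 1 when i + j = k and 0
   otherwise. *)
have EGF : E^T *m G *m F = Qmx C k.+1.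
  apply/matrixP=> i j; rewrite gram_chain_mx // xy !mxE /= mulr1n; congr (_%:R).
  by have := ltn_ord i; have := ltn_ord j; lia.
have FGE : F^T *m G *m E = - Qmx C k.+1.
  rewrite -tr_Qmx -EGF !trmx_mul trmxK skG mulNmx mulmxN opprK mulmxA; congr (_ *m _ *m _).
have YGY : (row_mx E F)^T *m G *m row_mx E F = block_mx 0 (Qmx C k.+1) (- Qmx C k.+1) 0.
  by rewrite tr_row_mx mul_col_mx mul_col_row EGE EGF FGE FGF.
have BY : B *m row_mx E F
    = row_mx E F *m block_mx (jordan k.+1 lam) 0 0 (jordan k.+1 lam).
  by rewrite mul_mx_row BE BF mul_row_block !mulmx0 addr0 add0r.
have [|r [X [B' [dim YGX BX uG' eigB']]]] := orthocomplement_split uG skG GB _ BY.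
  by rewrite YGY skew_Qblock_unit.
have [EGX FGX] : E^T *m G *m X = 0 /\ F^T *m G *m X = 0.
  move: YGX; rewrite tr_row_mx !mul_col_mx -(@col_mx0 C k.+1 k.+1 r) => /eq_col_mx.
  by case.
have [||||s [T [dimT eigT B'T TGT]]] := IH r _ (X^T *m G *m X) B' => //.
- by lia.
- by rewrite !trmx_mul trmxK skG mulNmx mulmxN mulmxA.
- by rewrite -mulmxA -BX mulmxA -(mulmxA X^T) GB !mulmxA -trmx_mul BX trmx_mul.
exists ((k.+1, lam) :: s), (row_mx E (row_mx F (X *m T))); split.
- by rewrite /= dimT addnA.
- move=> p; rewrite inE => /predU1P[->|/eigT[? /eigB']] //.
- rewrite /= !mul_mx_row BE BF mulmxA BX -mulmxA B'T.
  rewrite /jordan_diag /= /pair_block mul_row_block mul_row_block mul_row_col.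
  by rewrite mul_mx_row add_row_mx !(mulmx0, addr0, add0r) mulmxA.
have XGE : X^T *m G *m E = 0.
  apply: (can_inj trmxK).
  by rewrite trmx0 !trmx_mul trmxK skG mulNmx mulmxN mulmxA EGX oppr0.
have XGF : X^T *m G *m F = 0.
  apply: (can_inj trmxK).
  by rewrite trmx0 !trmx_mul trmxK skG mulNmx mulmxN mulmxA FGX oppr0.
rewrite /Qskew /= /pair_block tr_row_mx mul_col_mx mul_col_row mul_mx_row tr_row_mx.
rewrite (mul_col_mx F^T _ G) mul_col_row mul_col_mx EGE EGF FGE FGF trmx_mul !mulmxA EGX FGX.
by rewrite !mul0mx -!(mulmxA T^T) XGE XGF !mulmx0 -/(Qskew s) -TGT !mulmxA.
Qed.

End PairBlocks.

(** * Comparison of [bdiag] with the paired block matrices across size casts *)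

Section BlockDiagonal.
Variable C : numClosedFieldType.
Implicit Types (s : seq (nat * C)) (x y z : {k : nat & 'M[C]_k}).

(** Packing a matrix with its size allows plain equality, hence rewriting, between matrices whose
    sizes are only provably equal. *)
Definition sized_mx k (A : 'M[C]_k) : {k : nat & 'M[C]_k} := existT _ k A.

Lemma sized_mx_castmx m n (A : 'M[C]_m) (B : 'M[C]_n) :
  sized_mx A = sized_mx B -> forall E : m = n, castmx (E, E) A = B.
Proof.
move=> AB E; case: n / E B AB => B AB; rewrite castmx_id.
(* [conform_mx B] gives the second component a type that does not depend on the pair, so [congr1]
   applies. *)
by have := congr1 (fun t => conform_mx B (projT2 t)) AB; rewrite /= !conform_mx_id.
Qed.

Lemma castmx_sized_mx m n (E : m = n) (A : 'M[C]_m) :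
  sized_mx (castmx (E, E) A) = sized_mx A.
Proof. by case: n / E; rewrite castmx_id. Qed.

Definition dsum x y := sized_mx (block_mx (projT2 x) 0 0 (projT2 y)).

Lemma dsumA x y z : dsum x (dsum y z) = dsum (dsum x y) z.
Proof.
case: x y z => [k A] [l B] [m D]; rewrite /dsum /=.
have -> : block_mx A 0 0 (block_mx B 0 0 D)
    = block_mx A (row_mx 0 0) (col_mx 0 0) (block_mx B 0 0 D).
  by rewrite row_mx0 col_mx0.
by rewrite block_mxA castmx_sized_mx row_mx0 col_mx0.
Qed.

Lemma dsum0x x : dsum (sized_mx (0 : 'M_0)) x = x.
Proof.
case: x => k A; rewrite /dsum /=; congr (@sized_mx k _); apply/matrixP=> i j.
have shift0 (l : 'I_k) : rshift 0 l = l by apply: val_inj.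
by rewrite -[RHS](block_mxEdr (0 : 'M[C]_0) 0 0 A) !shift0.
Qed.

Lemma bdiag_cat (r1 r2 : seq {k : nat & 'M[C]_k}) :
  sized_mx (bdiag (r1 ++ r2)) = dsum (sized_mx (bdiag r1)) (sized_mx (bdiag r2)).
Proof.
elim: r1 => [|x r1 IH]; first by rewrite dsum0x.
by rewrite -[LHS]/(dsum x (sized_mx (bdiag (r1 ++ r2)))) IH dsumA.
Qed.

Lemma bdiag_jordan_blocks s : sized_mx (bdiag (jordan_blocks s)) = sized_mx (jordan_diag s).
Proof.
elim: s => [//|p s IH]; pose x := sized_mx (jordan p.1 p.2).
rewrite -[LHS]/(dsum x (dsum x (sized_mx (bdiag (jordan_blocks s))))) IH.
by rewrite /jordan_diag /= /pair_block row_mx0 col_mx0.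
Qed.

Lemma bdiag_Q_blocks s : sized_mx (bdiag (Q_blocks s)) = sized_mx (Qdiag s).
Proof.
elim: s => [//|p s IH]; pose x := sized_mx (Qmx C p.1); pose y := sized_mx (- Qmx C p.1).
rewrite -[LHS]/(dsum x (dsum y (sized_mx (bdiag (Q_blocks s))))) IH.
by rewrite /Qdiag /= /pair_block row_mx0 col_mx0.
Qed.

Lemma castmx_bdiag_jordan s E :
  castmx (E, E) (bdiag (jordan_blocks s ++ jordan_blocks s))
  = block_mx (jordan_diag s) 0 0 (jordan_diag s).
Proof. by apply: sized_mx_castmx; rewrite bdiag_cat bdiag_jordan_blocks. Qed.

Lemma castmx_bdiag_Q s E :
  castmx (E, E) (bdiag (Q_blocks s ++ Q_blocks s)) = block_mx (Qdiag s) 0 0 (Qdiag s).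
Proof. by apply: sized_mx_castmx; rewrite bdiag_cat bdiag_Q_blocks. Qed.

Lemma sumn_jordan_blocks s :
  sumn [seq projT1 x | x <- jordan_blocks s ++ jordan_blocks s]
  = (pair_dim s + pair_dim s)%N.
Proof.
have := bdiag_cat (jordan_blocks s) (jordan_blocks s).
by rewrite bdiag_jordan_blocks => /(congr1 (@projT1 _ _)).
Qed.

Lemma sumn_Q_blocks s :
  sumn [seq projT1 x | x <- Q_blocks s ++ Q_blocks s] = (pair_dim s + pair_dim s)%N.
Proof.
have := bdiag_cat (Q_blocks s) (Q_blocks s).
by rewrite bdiag_Q_blocks => /(congr1 (@projT1 _ _)).
Qed.

End BlockDiagonal.

(** * Roots of Jordan blocks that are selfadjoint for Q (+) -Q *)

Section JordanRoots.
Variable C : numClosedFieldType.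

Lemma exprD_mod2 (R : comNzRingType) (p z : R) m :
  exists r, (p + z) ^+ m.+1 = p ^+ m.+1 + m.+1%:R * p ^+ m * z + z ^+ 2 * r.
Proof.
elim: m => [|m [r IH]]; first by exists 0; ring.
exists (m.+1%:R * p ^+ m + (p + z) * r); rewrite exprS IH !exprS -!natr1; ring.
Qed.

(* Newton iteration, one order of vanishing at a time. *)
Lemma poly_root_mod (lam : C) m k : lam != 0 ->
  exists p : {poly C}, ('X - lam%:P) ^+ k.+1 %| p ^+ m.+1 - 'X.
Proof.
move=> nz; set l := 'X - lam%:P; elim: k => [|k [p /dvdpP[h hE]]].
  (* Modulo X - lam, the polynomial X is the constant lam, so a constant root suffices. *)
  exists ((m.+1.-root lam)%:P); rewrite -rmorphXn /= rootCK // -opprB dvdpNr.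
  by rewrite dvdpp.
pose mu := p.[lam].
have muE : mu ^+ m.+1 = lam.
  have := congr1 (fun q => q.[lam]) hE.
  rewrite !hornerE /= subrr expr0n /= mulr0 => /eqP.
  by rewrite subr_eq0 => /eqP.
have nzmu : mu != 0 by apply: contraNneq nz => m0; rewrite -muE m0 expr0n.
(* This c makes h + (m+1) p^m c vanish at lam, which gains one more factor X - lam. *)
pose c := - h.[lam] / (m.+1%:R * mu ^+ m).
exists (p + c%:P * l ^+ k.+1); have [r ->] := exprD_mod2 p (c%:P * l ^+ k.+1) m.
have /dvdpP[g gE] : l %| h + m.+1%:R * p ^+ m * c%:P.
  rewrite dvdp_XsubCl rootE !hornerE -/mu hornerMn hornerE /c.
  by rewrite /= mulrAC divff ?mul1r ?subrr // mulf_neq0 ?expf_neq0 // pnatr_eq0.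
have -> : p ^+ m.+1 + m.+1%:R * p ^+ m * (c%:P * l ^+ k.+1) + (c%:P * l ^+ k.+1) ^+ 2 * r - 'X
   = l ^+ k.+2 * (g + c%:P ^+ 2 * l ^+ k * r).
  transitivity ((p ^+ m.+1 - 'X) + m.+1%:R * p ^+ m * c%:P * l ^+ k.+1
                + (c%:P * l ^+ k.+1) ^+ 2 * r).
    ring.
  rewrite hE -mulrDl gE !exprS; ring.
exact: dvdp_mulr.
Qed.

Lemma jordan_nilpotent k (lam : C) : horner_mx (jordan k.+1 lam) (('X - lam%:P) ^+ k.+1) = 0.
Proof.
(* The transpose is lower triangular, the shape required by [char_poly_trig]; Cayley-Hamilton then
   concludes. *)
apply: (can_inj trmxK); rewrite trmx0 tr_horner_mx.
have <- : char_poly (jordan k.+1 lam)^T = ('X - lam%:P) ^+ k.+1.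
  rewrite char_poly_trig => [|]; last first.
    apply/is_trig_mxP=> i j ltij; rewrite !mxE.
    by rewrite gtn_eqF // ltn_eqF // ltnS ltnW.
  under eq_bigr => i _ do rewrite !mxE eqxx.
  by rewrite prodr_const card_ord.
exact: Cayley_Hamilton.
Qed.

(** R is a polynomial in the Jordan block, so it inherits the relation with Q. That relation
    involves the transpose and not the adjoint, since R may be non-real. *)
Lemma jordan_root m k (lam : C) : lam != 0 ->
  exists R : 'M[C]_k, R ^+ m.+1 = jordan k lam /\ Qmx C k *m R = R^T *m Qmx C k.
Proof.
case: k => [|k] nz; first by exists 0; split; apply/matrixP=> [] [].
have [p /dvdpP[h hE]] := poly_root_mod m k nz.
exists (horner_mx (jordan k.+1 lam) p); split; last first.
  by rewrite tr_horner_mx (horner_mx_intertwine _ (Qmx_jordan _ _)).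
rewrite -rmorphXn /= -[p ^+ _](subrK 'X) hE rmorphD rmorphM /= jordan_nilpotent.
by rewrite mulr0 add0r horner_mx_X.
Qed.

Lemma expr_conjugate n (V V' Y : 'M[C]_n) m :
  V' *m V = 1%:M -> (V *m Y *m V') ^+ m = V *m (Y ^+ m) *m V'.
Proof.
move=> V'V; elim: m => [|m IH]; first by rewrite !expr0 mulmx1 (mulmx1C V'V).
by rewrite !exprS IH -!mulmxE !mulmxA -(mulmxA _ V') V'V mulmx1.
Qed.

Lemma cmx_jordan k (lam : C) : lam \is Num.real -> cmx (jordan k lam) = jordan k lam.
Proof.
move=> /CrealP lamR; apply/matrixP=> i j; rewrite !mxE.
by case: ifP => _; [|case: ifP => _]; rewrite ?lamR ?rmorph1 ?rmorph0.
Qed.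

Lemma adjmx_pair_block k r (a b c e : 'M[C]_k) (X : 'M[C]_r) :
  adjmx (pair_block a b c e X)
  = pair_block (adjmx a) (adjmx c) (adjmx b) (adjmx e) (adjmx X).
Proof. by rewrite /adjmx /Defs.conjmx map_pair_block tr_pair_block. Qed.

Lemma jordan_diag_root m (s : seq (nat * C)) :
    {in s, forall p, p.2 < 0} ->
  exists X : 'M[C]_(pair_dim s),
    X ^+ m.+1 = jordan_diag s /\ Qdiag s *m X = adjmx X *m Qdiag s.
Proof.
elim: s => [|[k lam] s IH] neg; first by exists 0; split; apply/matrixP=> [] [].
have [|X [Xm QX]] := IH; first by move=> p sp; apply: neg; rewrite inE sp orbT.
have /= lam_lt0 := neg _ (mem_head _ _).
have [R [Rm QR]] := jordan_root m k (negbT (lt_eqF lam_lt0)).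
pose R' := cmx R; pose h : C := 2^-1.
have R'm : R' ^+ m.+1 = jordan k lam.
  rewrite -(cmx_jordan k (ltr0_real lam_lt0)) -Rm /R' /Defs.conjmx.
  by elim: (m.+1) => [|a IHa]; rewrite ?expr0 ?map_mx1 // !exprS -!mulmxE map_mxM IHa.
have QR' : Qmx C k *m R' = R'^T *m Qmx C k.
  have := congr1 (map_mx (Num.conj : {rmorphism C -> C})) QR.
  by rewrite !map_mxM map_Qmx -map_trmx.
(* On the two copies, V^T (Q (+) -Q) V is twice [[0, Q], [Q, 0]]. For this form, selfadjointness of
   diag(R, R') relates R' to the adjoint of R, which is the transpose of R'. [V'] is the inverse of
   [V], hence the factor 1/2. *)
pose V : 'M[C]_(k + (k + pair_dim s)) := pair_block 1%:M 1%:M 1%:M (- 1%:M) 1%:M.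
pose V' : 'M[C]_(k + (k + pair_dim s)) := pair_block h%:M h%:M h%:M (- h%:M) 1%:M.
have hh (A : 'M[C]_k) : h *: A + h *: A = A.
  by rewrite -scalerDl -mulr2n -[h]mul1r -mulr_natr /h mul1r mulVf ?pnatr_eq0 // scale1r.
have V'V : V' *m V = 1%:M.
  rewrite pair_blockM !mulmxN !mulmx1 opprK subrr -pair_block1.
  have -> : h%:M + h%:M = 1%:M :> 'M[C]_k.
    by rewrite -[h%:M]mulmx1 mul_scalar_mx hh.
  by [].
exists (V *m pair_block R 0 0 R' X *m V'); split.
  rewrite expr_conjugate // pair_blockX Rm R'm Xm !pair_blockM.
  rewrite !(mulmx0, mul0mx, addr0, add0r, mul1mx, mulmx1, mulNmx, mulmxN, mul_mx_scalar).
  by rewrite !scalerN opprK !subrr hh.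
rewrite !pair_blockM !(mulmx0, mul0mx, addr0, add0r, mul1mx, mulmx1, mulNmx, mulmxN, mul_mx_scalar).
rewrite adjmx_pair_block /Qdiag /= !pair_blockM.
rewrite !(mulmx0, mul0mx, addr0, add0r, mulmxN, mulNmx) -/(Qdiag s) QX.
have hR : h^* = h by rewrite fmorphV /= conjC_nat.
have R'K : Defs.conjmx R' = R by apply/matrixP=> i j; rewrite !mxE conjCK.
rewrite !scalerN !opprK /adjmx /Defs.conjmx !map_mxD !map_mxN !map_mxZ /= hR.
rewrite -!/(Defs.conjmx _) -/R' R'K !linearD /= !linearN /= !linearZ /=.
rewrite !(mulmxDl, mulmxDr, mulNmx, mulmxN) -!scalemxAl QR QR' !scalerN !mulNmx !scalerN !opprK.
by congr pair_block; rewrite ?opprD ?opprK // addrC.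
Qed.
End JordanRoots.

(** * Algebra of entrywise conjugation and adjoints *)

Section ConjugateMatrices.
Variable C : numClosedFieldType.

Lemma cmxM m n p (A : 'M[C]_(m, n)) (B : 'M[C]_(n, p)) : cmx (A *m B) = cmx A *m cmx B.
Proof. exact: map_mxM. Qed.

Lemma cmxK m n (A : 'M[C]_(m, n)) : cmx (cmx A) = A.
Proof. by apply/matrixP=> i j; rewrite !mxE conjCK. Qed.

Lemma cmxD m n (A B : 'M[C]_(m, n)) : cmx (A + B) = cmx A + cmx B.
Proof. exact: map_mxD. Qed.

Lemma cmxN m n (A : 'M[C]_(m, n)) : cmx (- A) = - cmx A.
Proof. exact: map_mxN. Qed.

Lemma cmxZ m n z (A : 'M[C]_(m, n)) : cmx (z *: A) = z^* *: cmx A.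
Proof. exact: map_mxZ. Qed.

Lemma cmx1 n : cmx (1%:M : 'M[C]_n) = 1%:M.
Proof. exact: map_mx1. Qed.

Lemma cmx0 m n : cmx (0 : 'M[C]_(m, n)) = 0.
Proof. exact: map_mx0. Qed.

Lemma cmxX n (A : 'M[C]_n) a : cmx (A ^+ a) = cmx A ^+ a.
Proof.
by elim: a => [|a IH]; rewrite ?expr0 ?cmx1 // !exprS -!mulmxE cmxM IH.
Qed.

Lemma adjmxM m n p (A : 'M[C]_(m, n)) (B : 'M[C]_(n, p)) :
  adjmx (A *m B) = adjmx B *m adjmx A.
Proof. by rewrite /adjmx cmxM trmx_mul. Qed.

Lemma adjmxK m n (A : 'M[C]_(m, n)) : adjmx (adjmx A) = A.
Proof. by apply/matrixP=> i j; rewrite !mxE conjCK. Qed.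

Lemma adjmxD m n (A B : 'M[C]_(m, n)) : adjmx (A + B) = adjmx A + adjmx B.
Proof. by rewrite /adjmx cmxD linearD. Qed.

Lemma adjmxN m n (A : 'M[C]_(m, n)) : adjmx (- A) = - adjmx A.
Proof. by rewrite /adjmx cmxN linearN. Qed.

Lemma adjmxZ m n z (A : 'M[C]_(m, n)) : adjmx (z *: A) = z^* *: adjmx A.
Proof. by rewrite /adjmx cmxZ linearZ. Qed.

Lemma adjmx1 n : adjmx (1%:M : 'M[C]_n) = 1%:M.
Proof. by rewrite /adjmx cmx1 trmx1. Qed.

Lemma adjmx0 m n : adjmx (0 : 'M[C]_(m, n)) = 0.
Proof. by rewrite /adjmx cmx0 trmx0. Qed.

End ConjugateMatrices.

(** * A real polynomial in A that squares to -1 *)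

Section ComplexStructure.
Variable C : numClosedFieldType.

(* With p the product of the X - z over representatives z in the upper half
   plane of the roots of f, p and its conjugate are coprime and f divides their
   product; w is the part divisible by p of a symmetrised Bezout relation. *)
Lemma conj_partition_mod (f : {poly C}) : f \is monic ->
    (forall z, root f z -> z \isn't Num.real) ->
  exists w : {poly C}, w + map_poly Num.conj w = 1 /\ f %| w * map_poly Num.conj w.
Proof.
move=> monf nreal; have [rs] := closed_field_poly_normal f.
rewrite (monicP monf) scale1r => fE.
pose up z : C := if 0 < 'Im z then z else z^*.
have im0 z : z \in rs -> 'Im z != 0.
  move=> rsz; have /nreal : root f z by rewrite fE root_prod_XsubC.
  by apply: contra => /eqP /Creal_ImP.
have up_gt0 z : z \in rs -> 0 < 'Im (up z).
  move=> rsz; rewrite /up; case: ifPn => // /negP ngt; rewrite Im_conj oppr_gt0.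
  have := im0 z rsz; rewrite real_neqr_lt ?Creal_Im ?real0 // => /orP[//|/ngt[]].
pose p := \prod_(z <- rs) ('X - (up z)%:P); pose pb := map_poly Num.conj p.
have pbE : pb = \prod_(z <- rs) ('X - ((up z)^*)%:P) by rewrite /pb map_prod_XsubC.
have pbK : map_poly Num.conj pb = p.
  by rewrite pbE map_prod_XsubC; apply: eq_bigr => z _; rewrite /= conjCK.
have fdvd : f %| p * pb.
  rewrite fE pbE -big_split /= [X in _ %| X](_ : _ =
    (\prod_(z <- rs) ('X - z%:P)) * \prod_(z <- rs) ('X - (z^*)%:P)) ?dvdp_mulr //.
  rewrite -big_split; apply: eq_bigr => z _; rewrite /up /=.
  by case: ifP => // _; rewrite conjCK mulrC.
have cop : coprimep p pb.
  apply/Pdiv.ClosedField.coprimepP => x.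
  have -> : p = \prod_(z <- map up rs) ('X - z%:P) by rewrite big_map.
  rewrite root_prod_XsubC => /mapP[z rsz ->]; apply/negP; rewrite -/(root pb _).
  have -> : pb = \prod_(z <- map (fun z => (up z)^*) rs) ('X - z%:P) by rewrite big_map.
  rewrite root_prod_XsubC => /mapP[z' rsz' E].
  have := up_gt0 z rsz; rewrite E Im_conj oppr_gt0 => /lt_trans/(_ (up_gt0 z' rsz')).
  by rewrite ltxx.
have /Bezout_eq1_coprimepP[[a b] /= ab] := cop.
have ab' : map_poly Num.conj a * pb + map_poly Num.conj b * p = 1.
  by rewrite -pbK -rmorphM -[X in _ + X]rmorphM -rmorphD ab rmorph1.
pose w := (2^-1)%:P * (a + map_poly Num.conj b) * p.
have wc : map_poly Num.conj w = (2^-1)%:P * (map_poly Num.conj a + b) * pb.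
  rewrite /w !rmorphM rmorphD /= map_polyC /= fmorphV /= conjC_nat.
  congr (_ * (_ + _) * _); apply/polyP=> i.
  by rewrite !coef_map /= conjCK.
exists w; rewrite wc; split.
  have -> : w + (2^-1)%:P * (map_poly Num.conj a + b) * pb
     = (2^-1)%:P * ((a * p + b * pb) + (map_poly Num.conj a * pb + map_poly Num.conj b * p)).
    rewrite /w; ring.
  by rewrite ab ab' -polyC1 -polyCD -polyCM mulVf // (pnatr_eq0 C 2).
have -> : w * ((2^-1)%:P * (map_poly Num.conj a + b) * pb)
  = (2^-1)%:P * (a + map_poly Num.conj b) * ((2^-1)%:P * (map_poly Num.conj a + b)) * (p * pb).
  rewrite /w; ring.
exact: dvdp_mull.
Qed.

(** Unlike [horner_mx], this makes sense for a size such as d + d that is not visibly a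
    successor. *)
Definition poly_mx N (h : {poly C}) (A : 'M[C]_N) := \sum_(i < size h) h`_i *: A ^+ i.

Lemma poly_mx_horner n (h : {poly C}) (A : 'M[C]_n.+1) : poly_mx h A = horner_mx A h.
Proof.
rewrite -[h in RHS]coefK poly_def rmorph_sum; apply: eq_bigr => i _ /=.
by rewrite horner_mxZ rmorphXn /= horner_mx_X.
Qed.

Lemma poly_mx_intertwine N (h : {poly C}) (L A A' : 'M[C]_N) :
  L *m A = A' *m L -> L *m poly_mx h A = poly_mx h A' *m L.
Proof.
move=> LA; rewrite mulmx_sumr mulmx_suml; apply: eq_bigr => i _.
by rewrite -scalemxAr -scalemxAl (mulmx_expr_intertwine _ LA).
Qed.

Lemma cmx_poly_mx N (h : {poly C}) (A : 'M[C]_N) :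
  map_poly Num.conj h = h -> cmx (poly_mx h A) = poly_mx h (cmx A).
Proof.
move=> hR; have hiR i : (h`_i)^* = h`_i by rewrite -[in RHS]hR coef_map.
rewrite /poly_mx /Defs.conjmx raddf_sum; apply: eq_bigr => i _ /=.
by rewrite -!/(Defs.conjmx _) cmxZ cmxX hiR.
Qed.

Lemma adjmx_poly_mx N (h : {poly C}) (A : 'M[C]_N) :
  map_poly Num.conj h = h -> adjmx (poly_mx h A) = poly_mx h (adjmx A).
Proof.
move=> hR; rewrite /adjmx cmx_poly_mx // /poly_mx raddf_sum; apply: eq_bigr => i _ /=.
by rewrite linearZ /= trmx_expr.
Qed.

(** Modulo the characteristic polynomial, w and its conjugate wb are complementary idempotents. So h
    = i (wb - w) is fixed by conjugation, and h^2 = -(w + wb)^2 + 4 w wb reduces to -1. Reality of h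
    is what later keeps h(A) in Omega and selfadjoint. *)
Lemma poly_mx_complex_structure N (A : 'M[C]_N) :
    (forall z, eigenvalue A z -> z \isn't Num.real) ->
  exists h : {poly C}, map_poly Num.conj h = h
    /\ poly_mx h A *m poly_mx h A = - 1%:M.
Proof.
case: N A => [|n] A nreal.
  by exists 0; split; [rewrite rmorph0 | rewrite [LHS]flatmx0 [RHS]flatmx0].
have [|z|w [wc dvd]] := @conj_partition_mod (char_poly A).
- exact: char_poly_monic.
- by rewrite -eigenvalue_root_char; apply: nreal.
have wcc : map_poly Num.conj (map_poly Num.conj w) = w.
  by apply/polyP=> i; rewrite !coef_map /= conjCK.
pose wb := map_poly Num.conj w.
exists ('i%:P * (wb - w)); split.
  by rewrite rmorphM rmorphB /= map_polyC /= conjCi wcc polyCN mulNr -mulrN opprB.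
rewrite poly_mx_horner mulmxE -rmorphM /=.
have -> : 'i%:P * (wb - w) * ('i%:P * (wb - w)) = - 1 + 4%:R%:P * (w * wb).
  have -> : 'i%:P * (wb - w) * ('i%:P * (wb - w))
    = ('i ^+ 2)%:P * ((w + wb) ^+ 2 - 4%:R%:P * (w * wb)) :> {poly C}.
    rewrite polyCMn; ring.
  by rewrite wc sqrCi expr1n polyCN mulN1r opprB addrC.
have /dvdpP[q qE] := dvd.
rewrite qE rmorphD rmorphN rmorph1 !rmorphM /= Cayley_Hamilton !mulr0 addr0.
by [].
Qed.

End ComplexStructure.

(** * The antilinear map J and the canonical columns *)

Section Quaternionic.
Variable C : numClosedFieldType.

Lemma adjmx_Qmx k : adjmx (Qmx C k) = Qmx C k.
Proof.
by rewrite /adjmx /Defs.conjmx (map_Qmx (Num.conj : {rmorphism C -> C})) tr_Qmx.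
Qed.

Lemma cmx_pair_diag (a b c e : forall p : nat * C, 'M[C]_p.1) s :
  cmx (pair_diag a b c e s)
  = pair_diag (fun p => cmx (a p)) (fun p => cmx (b p))
      (fun p => cmx (c p)) (fun p => cmx (e p)) s.
Proof. exact: (map_pair_diag (Num.conj : {rmorphism C -> C})). Qed.

Lemma adjmx_pair_diag (a b c e : forall p : nat * C, 'M[C]_p.1) s :
  adjmx (pair_diag a b c e s)
  = pair_diag (fun p => adjmx (a p)) (fun p => adjmx (c p))
      (fun p => adjmx (b p)) (fun p => adjmx (e p)) s.
Proof. by rewrite /adjmx cmx_pair_diag tr_pair_diag. Qed.

Lemma cmx_jordan_diag (s : seq (nat * C)) :
  {in s, forall p, p.2 < 0} -> cmx (jordan_diag s) = jordan_diag s.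
Proof.
move=> neg; rewrite cmx_pair_diag; apply: eq_in_pair_diag => p /neg lt0.
by rewrite cmx0; split=> //; apply: cmx_jordan; apply: ltr0_real.
Qed.

Definition Kmx d : 'M[C]_(d + d) := block_mx 0 (- 1%:M) 1%:M 0.

Lemma Kmx_sqr d : Kmx d *m Kmx d = - 1%:M.
Proof.
rewrite mulmx_block !(mulmx0, mul0mx, addr0, add0r, mulmx1, mul1mx).
by rewrite (scalar_mx_block d d) opp_block_mx !oppr0.
Qed.

Lemma cmx_Kmx d : cmx (Kmx d) = Kmx d.
Proof.
by rewrite /Defs.conjmx map_block_mx !map_mx0 -!/(Defs.conjmx _) cmxN !cmx1.
Qed.

Lemma tr_Kmx d : (Kmx d)^T = - Kmx d.
Proof. by rewrite tr_block_mx !trmx0 linearN /= !trmx1 opp_block_mx opprK !oppr0. Qed.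

Lemma OmegaP d (M : 'M[C]_(d + d)) : Omega M <-> Kmx d *m cmx M = M *m Kmx d.
Proof.
have mulK (a b c e : 'M[C]_d) : (Kmx d *m cmx (block_mx a b c e) = block_mx a b c e *m Kmx d)
    <-> (cmx a = e /\ b = - cmx c).
  rewrite /Defs.conjmx map_block_mx -!/(Defs.conjmx _) !mulmx_block.
  rewrite !(mulmx0, mul0mx, addr0, add0r, mulmx1, mul1mx, mulNmx, mulmxN).
  split=> [/eq_block_mx[<- _ <- _] | [<- ->]]; first by [].
  by rewrite cmxK cmxN cmxK.
split=> [[A1 [A2 ->]]|]; first by apply/mulK; rewrite cmxN opprK.
rewrite -[M]submxK => /mulK[<- ->].
by exists (ulsubmx M), (- dlsubmx M); rewrite opprK cmxN.
Qed.

Definition Jmx d n (X : 'M[C]_(d + d, n)) := Kmx d *m cmx X.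

Lemma JmxM d n p (X : 'M[C]_(d + d, n)) (Y : 'M[C]_(n, p)) :
  Jmx (X *m Y) = Jmx X *m cmx Y.
Proof. by rewrite /Jmx cmxM mulmxA. Qed.

Lemma JmxK d n (X : 'M[C]_(d + d, n)) : Jmx (Jmx X) = - X.
Proof. by rewrite /Jmx cmxM cmx_Kmx cmxK mulmxA Kmx_sqr mulNmx mul1mx. Qed.

Lemma JmxD d n (X Y : 'M[C]_(d + d, n)) : Jmx (X + Y) = Jmx X + Jmx Y.
Proof. by rewrite /Jmx cmxD mulmxDr. Qed.

Lemma JmxZ d n z (X : 'M[C]_(d + d, n)) : Jmx (z *: X) = z^* *: Jmx X.
Proof. by rewrite /Jmx cmxZ scalemxAr. Qed.

Lemma Omega_Jmx d n (M : 'M[C]_(d + d)) (X : 'M[C]_(d + d, n)) :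
  Omega M -> Jmx (M *m X) = M *m Jmx X.
Proof. by move=> /OmegaP MK; rewrite /Jmx cmxM !mulmxA MK. Qed.

(** J (u1; u2) = (-conj u2; conj u1) is the second block column of an Omega matrix with A1 = u1 and
    A2 = -u2. *)
Lemma Omega_row_Jmx d (U : 'M[C]_(d + d, d)) : Omega (row_mx U (Jmx U)).
Proof.
rewrite -[U]vsubmxK; exists (usubmx U), (- dsubmx U).
rewrite /Jmx /Defs.conjmx map_col_mx -!/(Defs.conjmx _) mul_block_col.
rewrite !(mul0mx, mulNmx, mul1mx, addr0, add0r) opprK cmxN.
by rewrite -block_mxEh.
Qed.

(** From K^T = -K, H K = K conj(H) and K^2 = -1 it follows that K^T H K = conj(H). *)
Lemma adj_Jmx_form d n p (H : 'M[C]_(d + d)) (X : 'M[C]_(d + d, n)) (Y : 'M[C]_(d + d, p)) :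
  Omega H -> adjmx (Jmx X) *m H *m Jmx Y = cmx (adjmx X *m H *m Y).
Proof.
move=> /OmegaP HK; rewrite /Jmx adjmxM /adjmx cmx_Kmx tr_Kmx cmxK.
rewrite -!mulmxA (mulmxA H) -HK !mulmxA -(mulmxA _ _ (Kmx d)) mulNmx Kmx_sqr opprK mulmx1.
by rewrite !cmxM /Defs.conjmx -map_trmx -!/(Defs.conjmx _) cmxK.
Qed.

Lemma adj_form m n p (H : 'M[C]_m) (X : 'M[C]_(m, n)) (Y : 'M[C]_(m, p)) :
  herm_mx H -> adjmx (adjmx X *m H *m Y) = adjmx Y *m H *m X.
Proof. by move=> hH; rewrite !adjmxM hH adjmxK mulmxA. Qed.

(** The conjugate of the transposed Gram matrix pairs X with J X. Applying J to both arguments gives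
    back the original up to the sign of J^2 = -1. *)
Lemma skew_Jmx_form d n (H : 'M[C]_(d + d)) (X : 'M[C]_(d + d, n)) :
  Omega H -> herm_mx H -> (adjmx (Jmx X) *m H *m X)^T = - (adjmx (Jmx X) *m H *m X).
Proof.
move=> OH hH; rewrite -[LHS]cmxK; set G := _ *m X.
rewrite (_ : cmx G^T = adjmx X *m H *m Jmx X); last first.
  rewrite -(adj_form _ _ hH) /adjmx /Defs.conjmx -map_trmx //.
rewrite -adj_Jmx_form // JmxK /G -[in RHS]mulmxN.
by [].
Qed.

(** U supplies the first half of the columns of S; J U will be the second half. *)
Lemma quaternionic_canonical_columns d (H B Phi : 'M[C]_(d + d)) :
    Omega H -> H \in unitmx -> herm_mx H -> Omega B -> H_selfadjoint H B ->
    (forall a, eigenvalue B a -> a < 0) ->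
    Omega Phi -> H_selfadjoint H Phi -> Phi *m B = B *m Phi -> Phi *m Phi = - 1%:M ->
  exists s (U : 'M[C]_(d + d, pair_dim s)),
  [/\ pair_dim s = d, {in s, forall p, (0 < p.1)%N && (p.2 < 0)},
      B *m U = U *m jordan_diag s, adjmx U *m H *m U = Qdiag s
    & adjmx (Jmx U) *m H *m U = 0].
Proof.
move=> OH uH hH OB HB eigB OP HP PB PP.
pose h : C := 2^-1.
have hh n p (A : 'M[C]_(n, p)) : h *: (A + A) = A.
  by rewrite -mulr2n -scaler_nat scalerA mulVf ?scale1r // pnatr_eq0.
have hR : h^* = h by rewrite fmorphV /= conjC_nat.
(* X is an involution, and [P], [P'] are the spectral projections of Phi for i and -i. *)
pose X := 'i *: Phi.
have XX : X *m X = 1%:M.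
  by rewrite -scalemxAl -scalemxAr PP scalerA -expr2 sqrCi scaleN1r opprK.
pose P := h *: (1%:M - X); pose P' := h *: (1%:M + X).
have P1 : P + P' = 1%:M by rewrite -scalerDr addrCA subrK hh.
have PP' : P *m P' = 0.
  rewrite -scalemxAl -scalemxAr mulmxBl mul1mx mulmxDr mulmx1 XX.
  by rewrite [X + _]addrC subrr !scaler0.
have P'P : P' *m P = 0.
  rewrite -scalemxAl -scalemxAr mulmxDl mul1mx mulmxBr mulmx1 XX.
  by rewrite -opprB addrC subrr !scaler0.
have idP : P *m P = P by rewrite -[RHS]mulmx1 -P1 mulmxDr PP' addr0.
(* The adjoint conjugates i and so exchanges the projections. This is why the image of P is
   H-neutral. *)
have HPP : adjmx P *m H = H *m P'.
  rewrite adjmxZ adjmxD adjmx1 adjmxN adjmxZ hR conjCi scaleNr opprK.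
  by rewrite -scalemxAl -scalemxAr mulmxDl mulmxDr mul1mx mulmx1 -scalemxAl -[H *m X]scalemxAr HP.
have PBc : P *m B = B *m P.
  by rewrite -scalemxAl -scalemxAr mulmxBl mulmxBr mul1mx mulmx1 -scalemxAl PB scalemxAr.
have [r [R [Z [RZ ZR]]]] := idempotent_mx_factor idP.
have PR : P *m R = R by rewrite -RZ -mulmxA ZR mulmx1.
have P'R : P' *m R = 0 by rewrite -PR mulmxA P'P mul0mx.
have ZP : Z *m P = Z by rewrite -RZ mulmxA ZR mul1mx.
have ZP' : Z *m P' = 0 by rewrite -ZP -mulmxA PP' mulmx0.
(* Coordinates on JV in the basis J R. Together with Z they show that V and JV are complementary of
   equal dimension. *)
pose Z' := - (cmx Z *m Kmx d).
have RZ' : Jmx R *m Z' = P'.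
  rewrite /Z' mulmxN mulmxA -JmxM RZ /P JmxZ /Jmx cmxD cmxN cmxZ conjCi cmx1 hR.
  rewrite scaleNr opprK mulmxDr mulmx1 -scalemxAr (OmegaP Phi).1 // -scalemxAl mulmxDl.
  rewrite Kmx_sqr -scalemxAl -mulmxA Kmx_sqr mulmxN mulmx1.
  by rewrite -scalerN opprD opprK scalerN opprK.
have ZR' : Z' *m Jmx R = 1%:M.
  by rewrite /Z' mulNmx /Jmx mulmxA -(mulmxA _ (Kmx d) (Kmx d)) Kmx_sqr mulmxN mulmx1 mulNmx opprK
     -cmxM ZR cmx1.
have P'JR : P' *m Jmx R = Jmx R by rewrite -RZ' -mulmxA ZR' mulmx1.
have ZJR : Z *m Jmx R = 0 by rewrite -P'JR mulmxA ZP' mul0mx.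
have Z'R : Z' *m R = 0 by rewrite -[Z']mul1mx -ZR' -(mulmxA Z' _ Z') RZ' -mulmxA P'R mulmx0.
have dimr : (r + r)%N = (d + d)%N.
  apply/eqP; rewrite eqn_leq; apply/andP; split.
    apply: (@mulmx1_min C _ _ (col_mx Z Z') (row_mx R (Jmx R))).
    by rewrite mul_col_row ZR ZJR Z'R ZR' -scalar_mx_block.
  apply: (@mulmx1_min C _ _ (row_mx R (Jmx R)) (col_mx Z Z')).
  by rewrite mul_row_col RZ RZ'.
have RHR : adjmx R *m H *m R = 0.
  by rewrite -{1}PR adjmxM -(mulmxA _ _ H) HPP -!mulmxA P'R !mulmx0.
have JHJ : adjmx (Jmx R) *m H *m Jmx R = 0 by rewrite adj_Jmx_form // RHR cmx0.
pose G := adjmx (Jmx R) *m H *m R; pose B' := Z *m B *m R.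
have BR : B *m R = R *m B' by rewrite /B' !mulmxA RZ PBc -mulmxA PR.
have ZB : Z *m B = B' *m Z by rewrite /B' -!mulmxA RZ -PBc mulmxA ZP.
have skG : G^T = - G by apply: skew_Jmx_form.
have uG : G \in unitmx.
  (* R Z = 1 - J R Z', and the second term disappears because JV is H-neutral too. *)
  suff: G *m (Z *m invmx H *m adjmx Z') = 1%:M by case/mulmx1_unit.
  rewrite !mulmxA -(mulmxA _ R) RZ -[P](addrK P') P1 mulmxBr mulmx1.
  by rewrite -RZ' mulmxA JHJ mul0mx subr0 mulmxK // -adjmxM ZR' adjmx1.
have GB : G *m B' = B'^T *m G.
  rewrite /G -mulmxA -BR mulmxA -(mulmxA _ H) HB mulmxA -adjmxM -Omega_Jmx // BR JmxM.
  by rewrite adjmxM /adjmx cmxK !mulmxA.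
have [s [T [dims eigs BT TGT]]] := symplectic_selfadjoint_canonical uG skG GB.
have negs p : p \in s -> (0 < p.1)%N && (p.2 < 0).
  case/eigs=> -> /eigenvalueP[v vB nzv] /=; apply: eigB; apply/eigenvalueP.
  exists (v *m Z); first by rewrite -mulmxA ZB mulmxA vB scalemxAl.
  by apply: contraNneq nzv => vZ; rewrite -[v]mulmx1 -ZR mulmxA vZ mul0mx.
pose E := R *m T; pose F := Jmx E.
have conjD : cmx (jordan_diag s) = jordan_diag s.
  by apply: cmx_jordan_diag => p /negs/andP[].
have BE : B *m E = E *m jordan_diag s by rewrite mulmxA BR -mulmxA BT mulmxA.
have BF : B *m F = F *m jordan_diag s by rewrite -Omega_Jmx // BE JmxM conjD.
have EHE : adjmx E *m H *m E = 0.
  by rewrite adjmxM -!mulmxA (mulmxA H) (mulmxA (adjmx R)) (mulmxA (adjmx R)) RHR mul0mx mulmx0.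
have FHF : adjmx F *m H *m F = 0 by rewrite adj_Jmx_form // EHE cmx0.
have FHE : adjmx F *m H *m E = Qskew s.
  rewrite /F /E JmxM adjmxM /adjmx cmxK -/(adjmx _) -TGT /G.
  by rewrite !mulmxA.
have EHF : adjmx E *m H *m F = - Qskew s.
  rewrite -(adj_form _ _ hH) FHE adjmx_pair_diag -scaleN1r pair_diagZ.
  apply: eq_in_pair_diag => p _.
  by rewrite adjmxN adjmx0 adjmx_Qmx !scaleN1r oppr0 opprK.
have JE : Jmx E = F by [].
have JF : Jmx F = - E by apply: JmxK.
clearbody F E.
(* With E = (e, f) and F = (J e, J f) on each pair, E M1 + F M2 = (e - J f, e + J f). *)
pose M1 := @pair_diag C (fun=> 1%:M) (fun=> 1%:M) (fun=> 0) (fun=> 0) s.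
pose M2 := @pair_diag C (fun=> 0) (fun=> 0) (fun=> - 1%:M) (fun=> 1%:M) s.
have adjM1 : adjmx M1 = @pair_diag C (fun=> 1%:M) (fun=> 0) (fun=> 1%:M) (fun=> 0) s.
  rewrite adjmx_pair_diag; apply: eq_in_pair_diag => p _.
  by rewrite adjmx0 adjmx1.
have adjM2 : adjmx M2 = @pair_diag C (fun=> 0) (fun=> - 1%:M) (fun=> 0) (fun=> 1%:M) s.
  rewrite adjmx_pair_diag; apply: eq_in_pair_diag => p _.
  by rewrite adjmxN adjmx0 adjmx1.
have cM1 : cmx M1 = M1.
  rewrite cmx_pair_diag; apply: eq_in_pair_diag => p _.
  by rewrite cmx0 cmx1.
have cM2 : cmx M2 = M2.
  rewrite cmx_pair_diag; apply: eq_in_pair_diag => p _.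
  by rewrite cmxN cmx0 cmx1.
have M1D : M1 *m jordan_diag s = jordan_diag s *m M1.
  rewrite !pair_diagM; apply: eq_in_pair_diag => p _.
  by rewrite !(mulmx0, mul0mx, mulmx1, mul1mx, addr0, add0r).
have M2D : M2 *m jordan_diag s = jordan_diag s *m M2.
  rewrite !pair_diagM; apply: eq_in_pair_diag => p _.
  by rewrite !(mulmx0, mul0mx, mulmx1, mul1mx, mulNmx, mulmxN, addr0, add0r).
pose c : C := sqrtC h.
have cR : c^* = c by apply: geC0_conj; rewrite sqrtC_ge0 invr_ge0 ler0n.
have cc : c * c = h by rewrite -expr2 sqrtCK.
exists s, (c *: (E *m M1 + F *m M2)); split=> //.
- by move: dimr; rewrite !addnn dims => /double_inj.
- rewrite -scalemxAr -scalemxAl mulmxDr mulmxDl !mulmxA BE BF.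
  by rewrite -!mulmxA M1D M2D.
- transitivity (h *: (adjmx M1 *m (- Qskew s) *m M2 + adjmx M2 *m Qskew s *m M1)).
    rewrite -EHF -FHE adjmxZ cR -!scalemxAl -scalemxAr scalerA cc adjmxD !adjmxM.
    rewrite !(mulmxDl, mulmxDr) -!mulmxA !(mulmxA H) !(mulmxA (adjmx E)) !(mulmxA (adjmx F)).
    rewrite EHE FHF.
    by rewrite !mul0mx !mulmx0 add0r addr0 addrC.
  rewrite adjM1 adjM2 mulmxN mulNmx !pair_diagM -scaleN1r pair_diagZ pair_diagD pair_diagZ.
  apply: eq_in_pair_diag => p _.
  rewrite !(mulmx0, mul0mx, mulmx1, mul1mx, mulNmx, mulmxN, addr0, add0r, scaleN1r, opprK, oppr0).
  by rewrite subrr addNr scaler0 -opprD scalerN !hh.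
(* Here J U = c (F M1 - E M2). Each remaining term vanishes separately: M1 selects only e and M2
   only f, while [Qskew] pairs e with f. *)
- transitivity (h *: (adjmx M1 *m Qskew s *m M1 - adjmx M2 *m (- Qskew s) *m M2)).
    rewrite -EHF -FHE JmxZ JmxD !JmxM JE JF cM1 cM2 cR adjmxZ cR -!scalemxAl -scalemxAr scalerA cc.
    rewrite mulNmx adjmxD adjmxN !adjmxM.
    rewrite !(mulmxDl, mulmxDr, mulNmx) -!mulmxA !(mulmxA H) !(mulmxA (adjmx E)).
    rewrite !(mulmxA (adjmx F)).
    rewrite EHE FHF.
    by rewrite !mul0mx !mulmx0 oppr0 add0r addr0.
  rewrite adjM1 adjM2 mulmxN mulNmx opprK !pair_diagM pair_diagD pair_diagZ.
  rewrite -[RHS](scale0r (Qskew s)) pair_diagZ.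
  apply: eq_in_pair_diag => p _.
  rewrite !(mulmx0, mul0mx, mulmx1, mul1mx, mulNmx, mulmxN, addr0, add0r, opprK, oppr0, scale0r).
  by rewrite ?subrr ?addNr ?scaler0.
Qed.
End Quaternionic.

(** * Passage between canonical columns, the canonical form and selfadjoint roots *)

Section CanonicalForm.
Variable C : numClosedFieldType.

Definition paired_canonical_form d (H B : 'M[C]_(d + d)) :=
  exists (S : 'M[C]_(d + d)) (s : seq (nat * C))
         (E1 : sumn [seq projT1 x | x <- jordan_blocks s ++ jordan_blocks s] = (d + d)%N)
         (E2 : sumn [seq projT1 x | x <- Q_blocks s ++ Q_blocks s] = (d + d)%N),
  [/\ Omega S, S \in unitmx, all (fun p => (0 < p.1)%N && (p.2 < 0)) s,
      invmx S *m B *m S = castmx (E1, E1) (bdiag (jordan_blocks s ++ jordan_blocks s))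
    & adjmx S *m H *m S = castmx (E2, E2) (bdiag (Q_blocks s ++ Q_blocks s))].

Lemma Qdiag_sqr s : Qdiag s *m Qdiag s = 1%:M :> 'M[C]_(pair_dim s).
Proof.
rewrite pair_diagM -pair_diag1; apply: eq_in_pair_diag => p _.
by rewrite !(mulmx0, mul0mx, mulNmx, mulmxN, opprK, oppr0, addr0, add0r, Qmx_sqr).
Qed.

Lemma cmx_Qdiag s : cmx (Qdiag s) = Qdiag s :> 'M[C]_(pair_dim s).
Proof.
rewrite cmx_pair_diag; apply: eq_in_pair_diag => p _; rewrite cmxN cmx0.
by rewrite /Defs.conjmx (map_Qmx (Num.conj : {rmorphism C -> C})).
Qed.

(** Take S = [U, J U]. The Gram matrix of J U is the conjugate of that of U, hence the same real
    [Qdiag s], and its being an involution makes S invertible. *)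
Lemma paired_canonical_form_of_columns d (H B : 'M[C]_(d + d)) s
    (U : 'M[C]_(d + d, pair_dim s)) :
    Omega H -> herm_mx H -> Omega B -> pair_dim s = d ->
    {in s, forall p, (0 < p.1)%N && (p.2 < 0)} ->
    B *m U = U *m jordan_diag s -> adjmx U *m H *m U = Qdiag s ->
    adjmx (Jmx U) *m H *m U = 0 ->
  paired_canonical_form H B.
Proof.
(* Replacing d by [pair_dim s] lets the block lemmas absorb the casts. *)
move=> OH hH OB Ed; case: d / Ed H B U OH hH OB => H B U OH hH OB negs BU UHU JHU.
have UHJ : adjmx U *m H *m Jmx U = 0 by rewrite -(adj_form _ _ hH) JHU adjmx0.
pose S := row_mx U (Jmx U).
have SHS : adjmx S *m H *m S = block_mx (Qdiag s) 0 0 (Qdiag s).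
  have -> : adjmx S = col_mx (adjmx U) (adjmx (Jmx U)).
    by rewrite /adjmx /Defs.conjmx map_row_mx tr_row_mx.
  by rewrite mul_col_mx mul_col_row UHU UHJ JHU adj_Jmx_form // UHU cmx_Qdiag.
have uS : S \in unitmx.
  suff: (block_mx (Qdiag s) 0 0 (Qdiag s) *m adjmx S *m H) *m S = 1%:M.
    by case/mulmx1_unit.
  rewrite -!mulmxA [adjmx S *m _]mulmxA SHS mulmx_block !Qdiag_sqr.
  by rewrite !(mulmx0, mul0mx, addr0, add0r) -scalar_mx_block.
exists S, s, (sumn_jordan_blocks s), (sumn_Q_blocks s).
rewrite castmx_bdiag_jordan castmx_bdiag_Q; split=> //.
- exact: Omega_row_Jmx.
- exact/allP.
have conjD : cmx (jordan_diag s) = jordan_diag s.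
  by apply: cmx_jordan_diag => p /negs/andP[].
rewrite -mulmxA -[RHS](mulKmx uS); congr (_ *m _).
rewrite mul_mx_row BU -Omega_Jmx // BU JmxM conjD mul_row_block.
by rewrite !mulmx0 addr0 add0r.
Qed.

(** With X a selfadjoint root of [jordan_diag s], diag(X, conj X) lies in Omega. It is a root of
    both copies because the Jordan part is real, and conjugation by S carries it back. *)
Lemma selfadjoint_root_of_canonical_form d m (H B : 'M[C]_(d + d)) :
    paired_canonical_form H B ->
  exists A : 'M[C]_(d + d), Omega A /\ H_selfadjoint H A /\ A ^+ m.+1 = B.
Proof.
move=> [S [s [E1 [E2 [OS uS negs SBS SHS]]]]].
have Ed : pair_dim s = d.
  by apply: double_inj; rewrite -!addnn -sumn_jordan_blocks.
case: d / Ed H B S E1 E2 OS uS SBS SHS => H B S E1 E2 OS uS.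
rewrite castmx_bdiag_jordan castmx_bdiag_Q => SBS SHS.
have [|X [Xm QX]] := @jordan_diag_root C m s.
  by move=> p /(allP negs)/andP[].
have conjD : cmx (jordan_diag s) = jordan_diag s.
  by apply: cmx_jordan_diag => p /(allP negs)/andP[].
pose Y := block_mx X 0 0 (cmx X).
have OY : Omega Y by exists X, 0; rewrite cmx0 oppr0.
have OSi : Omega (invmx S).
  have SSi : cmx S *m cmx (invmx S) = 1%:M by rewrite -cmxM mulmxV // cmx1.
  apply/OmegaP; rewrite -[LHS](mulKmx uS) (mulmxA S) -((OmegaP S).1 OS).
  by rewrite -!mulmxA SSi mulmx1.
have Ym : Y ^+ m.+1 = block_mx (jordan_diag s) 0 0 (jordan_diag s).
  have -> a : Y ^+ a = block_mx (X ^+ a) 0 0 (cmx X ^+ a).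
    elim: a => [|a IH]; first by rewrite !expr0 -scalar_mx_block.
    by rewrite !exprS IH -!mulmxE mulmx_block !(mulmx0, mul0mx, addr0, add0r).
  by rewrite -cmxX Xm conjD.
have QY : block_mx (Qdiag s) 0 0 (Qdiag s) *m Y
    = adjmx Y *m block_mx (Qdiag s) 0 0 (Qdiag s).
  have -> : adjmx Y = block_mx (adjmx X) 0 0 (cmx (adjmx X)).
    rewrite /adjmx /Defs.conjmx map_block_mx tr_block_mx !map_mx0 !trmx0.
    by rewrite !map_trmx.
  rewrite !mulmx_block !(mulmx0, mul0mx, addr0, add0r) QX; congr block_mx.
  by rewrite -{1}cmx_Qdiag -cmxM QX cmxM cmx_Qdiag.
exists (S *m Y *m invmx S); split; [|split].
- apply/OmegaP; move: OS OY OSi => /OmegaP OS /OmegaP OY /OmegaP OSi.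
  by rewrite !cmxM !mulmxA OS -(mulmxA S) OY -!mulmxA OSi.
- have SiS : adjmx S *m adjmx (invmx S) = 1%:M by rewrite -adjmxM mulVmx // adjmx1.
  have -> : H = adjmx (invmx S) *m block_mx (Qdiag s) 0 0 (Qdiag s) *m invmx S.
    by rewrite -SHS !mulmxA -adjmxM mulmxV // adjmx1 mul1mx mulmxK.
  rewrite /H_selfadjoint !adjmxM !mulmxA mulmxKV // -(mulmxA _ (adjmx S)) SiS mulmx1.
  by rewrite -(mulmxA _ _ Y) QY !mulmxA.
rewrite expr_conjugate ?mulVmx // Ym -SBS !mulmxA mulmxV // mul1mx.
by rewrite mulmxK.
Qed.

End CanonicalForm.

Theorem mainTheorem8 (C : numClosedFieldType) (n m : nat)
    (Ht Bt : 'M[C]_(n.*2 + n.*2)) :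
  (0 < m)%N -> ~~ odd m ->
  Omega Ht -> Ht \in unitmx -> herm_mx Ht ->
  Omega Bt -> H_selfadjoint Ht Bt ->
  (forall lam : C, eigenvalue Bt lam -> lam < 0) ->
  (exists At : 'M[C]_(n.*2 + n.*2),
      Omega At /\ H_selfadjoint Ht At /\ At ^+ m = Bt)
  <->
  (exists (S : 'M[C]_(n.*2 + n.*2)) (s : seq (nat * C))
          (E1 : sumn [seq projT1 x | x <- jordan_blocks s ++ jordan_blocks s]
                = (n.*2 + n.*2)%N)
          (E2 : sumn [seq projT1 x | x <- Q_blocks s ++ Q_blocks s]
                = (n.*2 + n.*2)%N),
      [/\ Omega S, S \in unitmx,
          all (fun p => (0 < p.1)%N && (p.2 < 0)) s,
          invmx S *m Bt *m S
            = castmx (E1, E1) (bdiag (jordan_blocks s ++ jordan_blocks s))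
        & adjmx S *m Ht *m S
            = castmx (E2, E2) (bdiag (Q_blocks s ++ Q_blocks s))]).
Proof.
move=> m_gt0 even_m OH uH hH OB HB eigB; split; last first.
  case: m m_gt0 even_m => // m _ _; exact: selfadjoint_root_of_canonical_form.
case=> A [OA [HA Am]].
(* A real eigenvalue z of A would give Bt the eigenvalue z^m, which is nonnegative since m is
   even. *)
have eigA z : eigenvalue A z -> z \isn't Num.real.
  case/eigenvalueP=> v vA nzv; apply/negP=> zR.
  suff /eigB : eigenvalue Bt (z ^+ m).
    by move=> /lt_geF; rewrite real_exprn_even_ge0.
  apply/eigenvalueP; exists v => //; rewrite -Am.
  elim: (m) => [|a IH]; first by rewrite !expr0 mulmx1 scale1r.
  by rewrite !exprS -mulmxE mulmxA vA -scalemxAl IH scalerA.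
have [h [hR PP]] := poly_mx_complex_structure eigA.
have [| | |s [U [Ed negs BU UHU JHU]]] :=
    quaternionic_canonical_columns OH uH hH OB HB eigB _ _ _ PP.
- by apply/OmegaP; rewrite cmx_poly_mx // (poly_mx_intertwine _ ((OmegaP A).1 OA)).
- by rewrite /H_selfadjoint adjmx_poly_mx // (poly_mx_intertwine _ HA).
(* h(A) commutes with Bt, since Bt is a power of A. *)
- rewrite -(poly_mx_intertwine _ (A := A)) // -Am.
  by rewrite (mulmx_expr_intertwine (A' := A)).
exact: paired_canonical_form_of_columns OH hH OB Ed negs BU UHU JHU.
Qed.
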